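(* The unique pseudo-expectation property is hereditary from above, as is the faithful unique pseudo-expectation property. That is: if a $C^*$-inclusion $(\mathcal{C},\mathcal{D})$ has the unique pseudo-expectation property (respectively, the faithful unique pseudo-expectation property) and $\mathcal{C}_0$ is a $C^*$-algebra with $\mathcal{D}\subseteq\mathcal{C}_0\subseteq\mathcal{C}$, then $(\mathcal{C}_0,\mathcal{D})$ has the unique pseudo-expectation property (respectively, the faithful unique pseudo-expectation property).
   Context: All $C^*$-algebras are unital. A $C^*$-inclusion $(\mathcal{C},\mathcal{D})$ is a pair of unital $C^*$-algebras with $\mathcal{D} \subseteq \mathcal{C}$ and having the same unit. ''ucp'' means unital completely positive. A $C^*$-algebra is injective if it is an injective object in the category of operator systems and ucp maps. $I(\mathcal{D})$ denotes a fixed injective envelope of $\mathcal{D}$: an injective unital $C^*$-algebra containing $\mathcal{D}$ as a unital $C^*$-subalgebra, such that for every injective operator system $\mathcal{S}$ and unital complete isometry $\tau:\mathcal{D}\to\mathcal{S}$ there is a unital complete isometry $\tau_1:I(\mathcal{D})\to\mathcal{S}$ with $\tau_1|_{\mathcal{D}}=\tau$. A pseudo-expectation for $(\mathcal{C},\mathcal{D})$ is a ucp map $\Phi:\mathcal{C}\to I(\mathcal{D})$ with $\Phi|_{\mathcal{D}}=\operatorname{id}$. The inclusion has the unique pseudo-expectation property if exactly one pseudo-expectation $\Phi$ exists, and the faithful unique pseudo-expectation property if in addition $\Phi$ is faithful, i.e. $\Phi(x^*x)=0$ implies $x=0$. *)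

(* Defs.v *)
From HB Require Import structures.
From mathcomp Require Import all_boot all_order all_algebra.
From mathcomp Require Import complex.
From mathcomp Require Import all_classical all_reals all_analysis.

Set Implicit Arguments.
Unset Strict Implicit.
Unset Printing Implicit Defensive.

Import Order.TTheory GRing.Theory Num.Theory.
Import numFieldNormedType.Exports.

Local Open Scope classical_set_scope.
Local Open Scope ring_scope.

(* The product of a C*-algebra is a field of this mixin: HB rejects a structure
   inheriting from both rings and normed modules, whose only common descendants
   in MathComp are the numDomainTypes.  The norm of a normed module over R[i]
   takes its values in the nonnegative reals of R[i].  The zero algebra is
   allowed. *)
HB.mixin Record isCStar (R : realType) A of CompleteNormedModule R[i] A := {
  cone : A ;
  cmul : A -> A -> A ;
  star : A -> A ;
  cmulA : associative cmul ;
  cmul1l : left_id cone cmul ;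
  cmul1r : right_id cone cmul ;
  cmulDl : left_distributive cmul +%R ;
  cmulDr : right_distributive cmul +%R ;
  cmulZl : forall (a : R[i]) (x y : A), cmul (a *: x) y = a *: cmul x y ;
  cmulZr : forall (a : R[i]) (x y : A), cmul x (a *: y) = a *: cmul x y ;
  starD : {morph star : x y / x + y} ;
  starZ : forall (a : R[i]) (x : A), star (a *: x) = conjc a *: star x ;
  starM : forall x y : A, star (cmul x y) = cmul (star y) (star x) ;
  starK : involutive star ;
  norm_cmul_le : forall x y : A, `|cmul x y| <= `|x| * `|y| ;
  norm_star_cmul : forall x : A, `|cmul (star x) x| = `|x| ^+ 2
}.

#[short(type="cstarAlgType")]
HB.structure Definition CStarAlg (R : realType) :=
  {A of CompleteNormedModule R[i] A & isCStar R A}.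

Notation "x ** y" := (cmul x y) (at level 40, left associativity) : ring_scope.

Section Matrices.
Variables (R : realType) (A : cstarAlgType R) (n : nat).
Implicit Types (X Y : 'M[A]_n) (v : 'cV[A]_n).

(* X = Y^* Y for some Y in M_n(A) *)
Definition posmx X : Prop :=
  exists Y, forall i j, X i j = \sum_k star (Y k i) ** Y k j.

(* M_n(A) acts faithfully by adjointable operators on the right Hilbert module
   A^n, with inner product <v, w> = \sum_i star (v i) ** w i; the corresponding
   operator norm is the C*-norm of M_n(A). *)
Definition colnorm v : R :=
  Num.sqrt (complex.Re `|\sum_i star (v i 0) ** v i 0|).

Definition mxact X v : 'cV[A]_n := \col_i \sum_j X i j ** v j 0.

Definition mxnorm X : R :=
  sup [set colnorm (mxact X v) | v in [set v | colnorm v <= 1]].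

Definition mx_in (S : set A) X : Prop := forall i j, S (X i j).

End Matrices.

(* Operator systems are concrete: unital self-adjoint linear subspaces S of a
   C*-algebra A, with the matrix order and the matrix norms that M_n(S) inherits
   from M_n(A).  C*-subalgebras are also subsets of an ambient C*-algebra. *)
Section Subspaces.
Variables (R : realType) (A : cstarAlgType R).
Implicit Types S B D : set A.

Definition operator_system S : Prop :=
  [/\ S cone,
      forall (a : R[i]) (x y : A), S x -> S y -> S (a *: x + y) &
      forall x : A, S x -> S (star x)].

Definition cstar_subalgebra B : Prop :=
  [/\ operator_system B,
      forall x y : A, B x -> B y -> B (x ** y) &
      closed B].

Definition cstar_inclusion B D : Prop :=
  [/\ cstar_subalgebra B, cstar_subalgebra D & D `<=` B].

End Subspaces.

(* A map S -> T between subsets S of A and T of B is represented by a function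
   A -> B, whose values outside S are irrelevant. *)
Section Maps.
Variables (R : realType) (A B : cstarAlgType R).
Implicit Types (S D : set A) (T : set B) (f : A -> B).

Definition unital_linear S T f : Prop :=
  [/\ forall x : A, S x -> T (f x),
      forall (a : R[i]) (x y : A), S x -> S y -> f (a *: x + y) = a *: f x + f y &
      f cone = cone].

Definition ucp S T f : Prop :=
  unital_linear S T f /\
  forall (n : nat) (X : 'M[A]_n), mx_in S X -> posmx X -> posmx (map_mx f X).

Definition unital_complete_isometry S T f : Prop :=
  unital_linear S T f /\
  forall (n : nat) (X : 'M[A]_n), mx_in S X -> mxnorm (map_mx f X) = mxnorm X.

Definition cstar_embedding D f : Prop :=
  [/\ unital_linear D setT f,
      forall x y : A, D x -> D y -> f (x ** y) = f x ** f y,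
      forall x : A, D x -> f (star x) = star (f x) &
      forall x y : A, D x -> D y -> f x = f y -> x = y].

End Maps.

Definition injective_operator_system (R : realType) (B : cstarAlgType R)
    (T : set B) : Prop :=
  operator_system T /\
  forall (A : cstarAlgType R) (E F : set A),
    operator_system E -> operator_system F -> E `<=` F ->
    forall phi : A -> B, ucp E T phi ->
    exists psi : A -> B, ucp F T psi /\ forall x : A, E x -> psi x = phi x.

Section PseudoExpectations.
Variables (R : realType) (C : cstarAlgType R).

Definition injective_envelope (D : set C) (I : cstarAlgType R)
    (iota : C -> I) : Prop :=
  [/\ cstar_embedding D iota,
      injective_operator_system [set: I] &
      forall (B : cstarAlgType R) (S : set B), injective_operator_system S ->
      forall tau : C -> B, unital_complete_isometry D S tau ->
      exists tau1 : I -> B, unital_complete_isometry [set: I] S tau1 /\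
        forall d : C, D d -> tau1 (iota d) = tau d].

Variables (B D : set C) (I : cstarAlgType R) (iota : C -> I).

Definition pseudo_expectation (Phi : C -> I) : Prop :=
  ucp B [set: I] Phi /\ forall d : C, D d -> Phi d = iota d.

Definition faithful (Phi : C -> I) : Prop :=
  forall x : C, B x -> Phi (star x ** x) = 0 -> x = 0.

Definition is_unique_pseudo_expectation (Phi : C -> I) : Prop :=
  pseudo_expectation Phi /\
  forall Psi : C -> I, pseudo_expectation Psi ->
  forall x : C, B x -> Psi x = Phi x.

Definition unique_pseudo_expectation_property : Prop :=
  exists Phi : C -> I, is_unique_pseudo_expectation Phi.

Definition faithful_unique_pseudo_expectation_property : Prop :=
  exists Phi : C -> I, is_unique_pseudo_expectation Phi /\ faithful Phi.

End PseudoExpectations.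

(* Main.v *)
Require Import Defs.
From mathcomp Require Import all_boot all_order all_algebra.
From mathcomp Require Import complex.
From mathcomp Require Import all_classical all_reals all_analysis.

Local Open Scope classical_set_scope.

(** Uniqueness passes down to an intermediate algebra because, [I] being
    injective, every pseudo-expectation on the smaller algebra extends to the
    larger one ([pseudo_expectation_extend]); the extension is then forced to be
    the unique pseudo-expectation of the larger algebra.  Existence and
    faithfulness pass down by restriction. *)

(** Complete positivity restricts to any subspace because the matrix order of a
    subspace is the one inherited from the ambient algebra. *)
Lemma pseudo_expectation_sub (R : realType) (C I : cstarAlgType R)
    (B0 B D : set C) (iota Phi : C -> I) :
  B0 `<=` B -> pseudo_expectation B D iota Phi ->
  pseudo_expectation B0 D iota Phi.
Proof.
move=> sB [[[_ linPhi Phi1] posPhi] PhiD]; split=> //; split; first split=> //.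
  by move=> a x y /sB Bx /sB By; apply: linPhi.
by move=> n X B0X; apply: posPhi => i j; apply/sB/B0X.
Qed.

(** Injectivity of [I] extends the ucp map, and the values on [D] are kept since
    [D] lies in the smaller space. *)
Lemma pseudo_expectation_extend (R : realType) (C I : cstarAlgType R)
    (B0 B D : set C) (iota Psi : C -> I) :
  injective_operator_system [set: I] ->
  operator_system B0 -> operator_system B -> D `<=` B0 -> B0 `<=` B ->
  pseudo_expectation B0 D iota Psi ->
  exists Psi1, pseudo_expectation B D iota Psi1 /\
    forall x, B0 x -> Psi1 x = Psi x.
Proof.
move=> [_ injI] osB0 osB sD sB [ucpPsi PsiD].
have [Psi1 [ucpPsi1 Psi1E]] := injI C B0 B osB0 osB sB Psi ucpPsi.
exists Psi1; split=> //; split=> // d Dd.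
by rewrite Psi1E ?PsiD//; apply: sD.
Qed.

Lemma is_unique_pseudo_expectation_sub (R : realType) (C I : cstarAlgType R)
    (B0 B D : set C) (iota Phi : C -> I) :
  injective_operator_system [set: I] ->
  operator_system B0 -> operator_system B -> D `<=` B0 -> B0 `<=` B ->
  is_unique_pseudo_expectation B D iota Phi ->
  is_unique_pseudo_expectation B0 D iota Phi.
Proof.
move=> injI osB0 osB sD sB [pPhi uniqPhi].
split; first exact: pseudo_expectation_sub pPhi.
move=> Psi pPsi x B0x.
have [Psi1 [pPsi1 Psi1E]] :=
  pseudo_expectation_extend _ _ _ _ _ _ _ _ injI osB0 osB sD sB pPsi.
by rewrite -Psi1E// uniqPhi//; apply: sB.
Qed.

Theorem proposition2p6 (R : realType) (C : cstarAlgType R) (D C0 : set C)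
    (I : cstarAlgType R) (iota : C -> I)
    (inclCD : cstar_inclusion [set: C] D)
    (envI : injective_envelope D iota)
    (subC0 : cstar_subalgebra C0) (leDC0 : D `<=` C0) :
  (unique_pseudo_expectation_property [set: C] D iota ->
   unique_pseudo_expectation_property C0 D iota) /\
  (faithful_unique_pseudo_expectation_property [set: C] D iota ->
   faithful_unique_pseudo_expectation_property C0 D iota).
Proof.
have [[osC _ _] _ _] := inclCD.
have [_ injI _] := envI.
have [osC0 _ _] := subC0.
have uniq_sub Phi : is_unique_pseudo_expectation [set: C] D iota Phi ->
    is_unique_pseudo_expectation C0 D iota Phi.
  exact: is_unique_pseudo_expectation_sub.
split=> [[Phi uPhi]|[Phi [uPhi fPhi]]]; exists Phi; first exact: uniq_sub.
by split; [exact: uniq_sub | move=> x _; exact: fPhi].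
Qed.
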